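(* Let $d_\mathrm{A}, d_\mathrm{B}\ge 2$ and let $\mathcal{M}$ be a finite collection of projective measurements on $\mathbb{C}^{d_\mathrm{A}}$, with $r$ the radius of the insphere of the polytope generated by $\mathcal{M}$ (as defined in the context). Let $\rho_{\mathrm{A}\mathrm{B}}$ be a density operator on $\mathbb{C}^{d_\mathrm{A}}\otimes\mathbb{C}^{d_\mathrm{B}}$. Suppose there exist a unit-trace Hermitian operator $O_{\mathrm{A}\mathrm{B}}$ on $\mathbb{C}^{d_\mathrm{A}}\otimes\mathbb{C}^{d_\mathrm{B}}$ (not necessarily positive semidefinite) that admits a local-hidden-state (LHS) model for the measurements in $\mathcal{M}$, and a density operator $\gamma_\mathrm{A}$ on $\mathbb{C}^{d_\mathrm{A}}$, such that $$\rho_{\mathrm{A}\mathrm{B}} = \frac{1}{d_\mathrm{A}}\left[r\,O_{\mathrm{A}\mathrm{B}} + (1-r)\frac{\mathbb{I}_\mathrm{A}}{d_\mathrm{A}}\otimes O_\mathrm{B}\right] + \frac{d_\mathrm{A}-1}{d_\mathrm{A}}\,\gamma_\mathrm{A}\otimes O_\mathrm{B},\qquad O_\mathrm{B}=\operatorname{tr}_\mathrm{A}[O_{\mathrm{A}\mathrm{B}}].$$ Then $\rho_{\mathrm{A}\mathrm{B}}$ admits an LHS model for all POVM measurements on $\mathbb{C}^{d_\mathrm{A}}$.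
   Context: LHS model: an operator $X_{\mathrm{A}\mathrm{B}}$ on $\mathbb{C}^{d_\mathrm{A}}\otimes\mathbb{C}^{d_\mathrm{B}}$ admits an LHS model for a set of measurements on Alice's side (each measurement $x$ given by operators $\{M_{a|x}\}_a$, $M_{a|x}\ge 0$, $\sum_a M_{a|x}=\mathbb{I}_\mathrm{A}$) if there exist a probability density $q(\lambda)$ over a hidden variable $\lambda$, conditional probability distributions $P(a|x,\lambda)$, and density operators $\rho_\lambda$ on $\mathbb{C}^{d_\mathrm{B}}$ such that for every measurement $x$ in the set and every outcome $a$, $\operatorname{tr}_\mathrm{A}[(M_{a|x}\otimes\mathbb{I}_\mathrm{B})X_{\mathrm{A}\mathrm{B}}]=\int d\lambda\, q(\lambda)P(a|x,\lambda)\rho_\lambda$. Polytope and insphere: every unit-trace Hermitian operator on $\mathbb{C}^{d}$ can be written as $(\mathbb{I}_d+\vec v\cdot\vec\lambda)/d$, where $\vec\lambda$ is the vector of generalized Gell-Mann matrices and $\vec v\in\mathbb{R}^{d^2-1}$ is the generalized Bloch vector, normalized so that rank-one projectors correspond to unit vectors. Projective measurements are taken rank-one. The polytope generated by $\mathcal{M}$ is the convex hull of the Bloch vectors of all projectors appearing in the measurements of $\mathcal{M}$ (for qubits with measurements $(\mathbb{I}\pm\hat u_x\cdot\vec\sigma)/2$, the convex hull of the $\pm\hat u_x$); its insphere is the largest origin-centered sphere contained in it, of radius $r$. *)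

(* Defs.v *)
From HB Require Import structures.
From mathcomp Require Import all_boot all_order all_algebra.
From mathcomp Require Import all_classical all_reals all_analysis.
From mathcomp Require Import complex mxtens.

Set Implicit Arguments.
Unset Strict Implicit.
Unset Printing Implicit Defensive.

Import Order.TTheory GRing.Theory Num.Theory.
Local Open Scope ring_scope.

Section QDefs.
Variable R : realType.
Local Notation C := R[i].

Definition iC : C := Complex 0 1.

Definition adjmx m n (A : 'M[C]_(m, n)) : 'M[C]_(n, m) := (map_mx Num.conj A)^T.

Definition is_hermitian n (A : 'M[C]_n) : Prop := adjmx A = A.

Definition psd n (A : 'M[C]_n) : Prop :=
  forall v : 'cV[C]_n, 0 <= (adjmx v *m A *m v) 0 0.

Definition density n (A : 'M[C]_n) : Prop := psd A /\ \tr A = 1.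

Definition isPOVM d k (E : 'I_k -> 'M[C]_d) : Prop :=
  (forall a, psd (E a)) /\ \sum_(a < k) E a = 1%:M.

Definition rank1PVM d k (E : 'I_k -> 'M[C]_d) : Prop :=
  isPOVM E /\ forall a, E a *m E a = E a /\ \rank (E a) = 1%N.

Definition ptrA dA dB (X : 'M[C]_(dA * dB)) : 'M[C]_dB :=
  \matrix_(i, j) \sum_(a < dA) X (mxtens_index (a, i)) (mxtens_index (a, j)).

(* LHS model for the family of measurements {M x a}_a, x : I, on Alice's side.
   Hidden variable: an arbitrary probability space (T, mu) ("q(lambda) dlambda");
   P x a : response functions; sig : local hidden states.
   The operator-valued integral is written out entrywise (real and imaginary
   parts of each matrix entry). *)
Definition LHS_model dA dB (I : Type) (nout : I -> nat)
    (M : forall x : I, 'I_(nout x) -> 'M[C]_dA) (X : 'M[C]_(dA * dB)) : Prop :=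
  exists (dsp : measure_display) (T : measurableType dsp) (mu : probability T R)
         (P : forall x : I, 'I_(nout x) -> T -> R) (sig : T -> 'M[C]_dB),
    (forall l, density (sig l)) /\
    (forall x l, (forall a, 0 <= P x a l) /\ \sum_(a < nout x) P x a l = 1) /\
    (forall x a i j,
       let tgt := ptrA ((M x a *t (1%:M : 'M[C]_dB)) *m X) i j in
       mu.-integrable setT (fun l => (P x a l * complex.Re (sig l i j))%:E) /\
       mu.-integrable setT (fun l => (P x a l * complex.Im (sig l i j))%:E) /\
       (\int[mu]_l (P x a l * complex.Re (sig l i j))%:E = (complex.Re tgt)%:E)%E /\
       (\int[mu]_l (P x a l * complex.Im (sig l i j))%:E = (complex.Im tgt)%:E)%E).

Definition POVMs d := {k : nat & {E : 'I_k -> 'M[C]_d | isPOVM E}}.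
Definition POVM_nout d (x : POVMs d) : nat := projT1 x.
Definition POVM_eff d (x : POVMs d) : 'I_(POVM_nout x) -> 'M[C]_d :=
  proj1_sig (projT2 x).

(* index set of the d^2-1 generalized Gell-Mann matrices:
   pairs j<k with a flag (true = symmetric, false = antisymmetric),
   and diagonal ones indexed by l = 1..d-1 *)
Definition GMidx d : finType :=
  ({p : 'I_d * 'I_d | (p.1 < p.2)%N} * bool + {l : 'I_d | (0 < l)%N})%type.

Definition gellmann d (g : GMidx d) : 'M[C]_d :=
  match g with
  | inl (exist (j, k) _, true) => delta_mx j k + delta_mx k j
  | inl (exist (j, k) _, false) => (- iC) *: delta_mx j k + iC *: delta_mx k j
  | inr (exist l _) =>
      (Num.sqrt (2 / (l%:R * (l%:R + 1))))%:C%C *: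
        (\sum_(m < d | (m < l)%N) delta_mx m m - l%:R *: delta_mx l l)
  end.

(* normalization of the Gell-Mann family making pure states unit vectors *)
Definition kappa d : R := Num.sqrt ((d%:R * (d%:R - 1)) / 2).

Definition bloch d (X : 'M[C]_d) (v : GMidx d -> R) : Prop :=
  X = (d%:R)^-1 *: (1%:M + \sum_(g : GMidx d) (v g * kappa d)%:C%C *: gellmann g).

Definition in_hull d (S : (GMidx d -> R) -> Prop) (v : GMidx d -> R) : Prop :=
  exists (n : nat) (w : 'I_n -> R) (p : 'I_n -> GMidx d -> R),
    (forall i, S (p i)) /\ (forall i, 0 <= w i) /\ \sum_(i < n) w i = 1 /\
    forall g, v g = \sum_(i < n) w i * p i g.

Definition polytope d (X : Type) (nout : X -> nat)
    (M : forall x : X, 'I_(nout x) -> 'M[C]_d) : (GMidx d -> R) -> Prop :=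
  in_hull (fun v => exists x a, bloch (M x a) v).

Definition ball_in d (P : (GMidx d -> R) -> Prop) (r : R) : Prop :=
  forall u : GMidx d -> R, Num.sqrt (\sum_(g : GMidx d) u g ^+ 2) <= r -> P u.

Definition is_insphere_radius d (P : (GMidx d -> R) -> Prop) (r : R) : Prop :=
  0 <= r /\ ball_in P r /\ forall r', 0 <= r' -> ball_in P r' -> r' <= r.

End QDefs.

(* Main.v *)
(* Write a POVM as {E_a}. Each E_a / tr E_a is a density operator, so its Bloch
   vector has norm at most 1 (as tr (Y^2) <= (tr Y)^2 for Y >= 0), and r times it
   lies in the polytope; hence r E_a + (1 - r) (tr E_a / d) I = sum_s W_(a,s) M_s
   with W_(a,s) >= 0 and sum_s W_(a,s) = tr E_a, where s runs over the effects of the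
   finite family. With the hidden variable and response functions P_s of the model
   for O, put S_a = sum_s W_(a,s) P_s and answer a with probability
     S_a / d + tr (E_a gamma) (1 - sum_b S_b / d).
   The first summand reproduces the part of rho containing O; since the S_b weigh
   the hidden states to sum_b (r E_b + (1 - r) (tr E_b / d) I) = I, i.e. to O_B, the
   second one gives ((d - 1) / d) tr (E_a gamma) O_B. No decomposition of the E_a
   into rank-one effects is needed. *)
Require Import Defs.
From HB Require Import structures.
From mathcomp Require Import all_boot all_order all_algebra.
From mathcomp Require Import all_classical all_reals all_analysis.
From mathcomp Require Import complex mxtens.
From mathcomp Require Import ring lra.

Set Implicit Arguments.
Unset Strict Implicit.
Unset Printing Implicit Defensive.

Import Order.TTheory GRing.Theory Num.Theory.
Local Open Scope ring_scope.

(** * Double sums over pairs, and telescoping identities *)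

Lemma sum_pairs_lt (V : nmodType) n (F : 'I_n -> 'I_n -> V) :
  \sum_i \sum_j F i j =
  \sum_(p : 'I_n * 'I_n | (p.1 < p.2)%N) (F p.1 p.2 + F p.2 p.1) + \sum_i F i i.
Proof.
rewrite pair_bigA /= (bigID (fun p : 'I_n * 'I_n => (p.1 < p.2)%N)) /=.
rewrite [in X in _ + X = _](bigID (fun p : 'I_n * 'I_n => (p.2 < p.1)%N)) /= addrA.
congr (_ + _).
  rewrite big_split /=; congr (_ + _).
  rewrite (reindex_onto (fun p => (p.2, p.1)) (fun p => (p.2, p.1))) /=; last by case.
  by apply: eq_bigl => -[i j] /=; rewrite eqxx andbT; case: ltngtP.
rewrite (reindex_onto (fun i : 'I_n => (i, i)) (fun p => p.1)) /=; last first.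
  by move=> [i j] /= H; congr pair; apply/val_inj => /=; move: H; case: ltngtP.
by apply: eq_bigl => i; rewrite ltnn eqxx.
Qed.

Lemma sum_sig (V : nmodType) (T : finType) (P : pred T) (F : T -> V) :
  \sum_(s : {x | P x}) F (sval s) = \sum_(x | P x) F x.
Proof. exact/esym/big_sub. Qed.

(* Up to scale, the diagonal Gell-Mann matrices are the vectors (1, ..., 1, -l, 0, ..., 0):
   the next two lemmas are Parseval's identity and the completeness of this system
   together with the constant vector, both proved by telescoping. *)
Section Telescoping.
Variables (R : realType) (x : nat -> R).
Let S n := \sum_(0 <= i < n) x i.

Lemma sum_helmert_sq n : (0 < n)%N ->
  \sum_(1 <= l < n) (S l - l%:R * x l) ^+ 2 / (l%:R * (l%:R + 1)) =
  \sum_(0 <= l < n) x l ^+ 2 - S n ^+ 2 / n%:R.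
Proof.
case: n => // n _; elim: n => [|n IH].
  by rewrite big_geq // /S !big_nat1 divr1 subrr.
rewrite big_nat_recr //= IH [in RHS]big_nat_recr //=.
have -> : S n.+2 = S n.+1 + x n.+1 by rewrite /S big_nat_recr.
have n1 : n.+1%:R != 0 :> R by rewrite pnatr_eq0.
have n2 : n.+1%:R + 1 != 0 :> R by rewrite natr1 pnatr_eq0.
rewrite -[n.+2%:R]natr1; move: (n.+1%:R : R) n1 n2 => a n1 n2; field.
by rewrite n1 n2.
Qed.

Lemma sum_helmert n m : (m < n)%N ->
  \sum_(1 <= l < n) ((m < l)%N%:R - (m == l)%:R * l%:R) *
    ((S l - l%:R * x l) / (l%:R * (l%:R + 1))) = x m - S n / n%:R.
Proof.
elim: n => // n IH; rewrite ltnS leq_eqVlt => /orP[/eqP ->|mn].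
  have -> : S n.+1 = S n + x n by rewrite /S big_nat_recr.
  case: n {IH} => [|n]; first by rewrite big_geq // /S big_geq // add0r divr1 subrr.
  rewrite big_nat_recr //= big1_seq ?add0r; last first.
    move=> l /=; rewrite mem_index_iota => /andP[_ ln].
    by rewrite gtn_eqF // ltnNge ltnW // mul0r subr0 mul0r.
  have n1 : n.+1%:R != 0 :> R by rewrite pnatr_eq0.
  have n2 : n.+1%:R + 1 != 0 :> R by rewrite natr1 pnatr_eq0.
  rewrite ltnn eqxx mul1r sub0r -[n.+2%:R]natr1; move: (n.+1%:R : R) n1 n2 => a n1 n2; field.
  by rewrite n1 n2.
have -> : S n.+1 = S n + x n by rewrite /S big_nat_recr.
case: n mn IH => // n mn IH.
rewrite big_nat_recr //= IH // mn ltn_eqF // mul0r subr0 mul1r.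
have n1 : n.+1%:R != 0 :> R by rewrite pnatr_eq0.
have n2 : n.+1%:R + 1 != 0 :> R by rewrite natr1 pnatr_eq0.
rewrite -[n.+2%:R]natr1; move: (n.+1%:R : R) n1 n2 => a n1 n2; field.
by rewrite n1 n2.
Qed.

End Telescoping.

(** * Expansion of a unit-trace Hermitian matrix in Gell-Mann matrices *)

Section GellMann.
Variable R : realType.
Local Notation C := R[i].

Lemma sum_GMidx (V : nmodType) d (F : GMidx d -> V) :
  \sum_g F g = \sum_(p : {p : 'I_d * 'I_d | (p.1 < p.2)%N})
      (F (inl (p, true)) + F (inl (p, false))) + \sum_l F (inr l).
Proof.
rewrite big_sumType; congr (_ + _).
transitivity (\sum_p \sum_b F (inl (p, b))).
  by rewrite pair_bigA; apply: eq_bigr => -[].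
by apply: eq_bigr => p _; rewrite big_bool.
Qed.

Lemma sum_ord_gt0 (V : nmodType) d (F : nat -> V) :
  \sum_(l : {l : 'I_d | (0 < l)%N}) F (sval l) = \sum_(1 <= l < d) F l.
Proof.
rewrite (sum_sig _ (fun l : 'I_d => F l)) -(big_mkord (fun l => 0 < l)%N F).
case: d => [|d]; first by rewrite !big_geq.
rewrite big_ltn_cond //= big_nat_cond [RHS]big_nat_cond.
by apply: eq_bigl => -[|i] //=; rewrite ?andbF.
Qed.

(** The vector (1, ..., 1, -l) with l ones has squared norm l (l + 1); this factor brings it to 2,
    as for the off-diagonal matrices. *)
Definition helmert_scale (l : nat) : R := Num.sqrt (2 / (l%:R * (l%:R + 1))).

Lemma helmert_scale_sq l : helmert_scale l ^+ 2 = 2 / (l%:R * (l%:R + 1)).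
Proof. by rewrite sqr_sqrtr // divr_ge0 // mulr_ge0 ?ler0n // addr_ge0 ?ler0n. Qed.

Lemma gellmann_offdiag d p b : @gellmann R d (inl (p, b)) =
  (if b then 1 else - iC R) *: delta_mx (sval p).1 (sval p).2 +
  (if b then 1 else iC R) *: delta_mx (sval p).2 (sval p).1.
Proof. by case: p b => [[j k] jk] [] //=; rewrite !scale1r. Qed.

Lemma gellmann_diag d (l : {l : 'I_d | (0 < l)%N}) : @gellmann R d (inr l) =
  \sum_(m < d) (helmert_scale (sval l) *
    ((m < sval l)%N%:R - (m == sval l :> nat)%:R * (sval l)%:R))%:C%C *: delta_mx m m.
Proof.
case: l => l l0 /=; rewrite -/(helmert_scale l).
under [RHS]eq_bigr => m _ do rewrite rmorphM -scalerA rmorphB scalerBl.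
rewrite -scaler_sumr sumrB; congr (_ *: (_ - _)).
  rewrite [LHS]big_mkcond; apply: eq_bigr => m _.
  by case: ifP => _; rewrite ?rmorph1 ?scale1r ?rmorph0 ?scale0r.
rewrite (bigD1 l) //= eqxx mul1r rmorph_nat big1 ?addr0 // => m ml.
by rewrite -val_eqE in ml; rewrite (negbTE ml) mul0r rmorph0 scale0r.
Qed.

Variables (d : nat) (X : 'M[C]_d).
Hypotheses (d2 : (2 <= d)%N) (Xh : is_hermitian X) (Xtr : \tr X = 1).

(** A sequence on [nat], so that the telescoping lemmas apply; the default 0 is never read, as all
    sums stop below [d]. *)
Let x (k : nat) : R := if insub k is Some i then complex.Re (X i i) else 0.

(* Half the Hilbert-Schmidt products with the Gell-Mann matrices, which are orthogonal
   with squared norm 2; the Bloch vector is [d / kappa d] times this. *)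
Definition bloch_coord (g : GMidx d) : R :=
  match g with
  | inl (p, b) => let z := X (sval p).1 (sval p).2 in
                  if b then complex.Re z else - complex.Im z
  | inr l => helmert_scale (sval l) / 2 *
      (\sum_(0 <= m < sval l) x m - (sval l)%:R * x (sval l))
  end.

Lemma hermitian_entry i j : X j i = conjc (X i j).
Proof. by rewrite -{1}Xh !mxE. Qed.

Lemma diag_ord (i : 'I_d) : X i i = (x i)%:C%C.
Proof.
rewrite /x valK; have := hermitian_entry i i; case: (X i i) => a b [] /eqP.
by rewrite -addr_eq0 -mulr2n mulrn_eq0 /= => /eqP ->.
Qed.

Lemma sum_diag : \sum_(0 <= i < d) x i = 1.
Proof.
apply: (@complexI R); rewrite rmorph1 -Xtr /mxtrace big_mkord rmorph_sum.
by apply: eq_bigr => i _; rewrite diag_ord.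
Qed.

(** Off the diagonal, the two matrices of a pair recombine the real and imaginary parts of the
    entry; on it, [sum_helmert] yields each entry minus the mean, which is 1/d since the trace is
    1. *)
Lemma sum_bloch_coord :
  \sum_g (bloch_coord g)%:C%C *: gellmann R g = X - (d%:R)^-1 *: 1%:M.
Proof.
rewrite sum_GMidx [X in _ = X - _]matrix_sum_delta.
rewrite (sum_pairs_lt (fun i j => X i j *: delta_mx i j)) -addrA; congr (_ + _).
  rewrite -(sum_sig _ (fun p : 'I_d * 'I_d => X p.1 p.2 *: delta_mx p.1 p.2 +
     X p.2 p.1 *: delta_mx p.2 p.1)).
  apply: eq_bigr => p _; rewrite !gellmann_offdiag !scale1r.
  rewrite scalerDr scalerDr !scalerA addrACA -!scalerDl.
  rewrite /bloch_coord (hermitian_entry (sval p).1 (sval p).2); case: (X _ _) => a b.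
  by congr (_ *: _ + _ *: _); rewrite /iC; simpc.
under eq_bigr => l _ do rewrite gellmann_diag scaler_sumr.
rewrite exchange_big /= mx1_sum_delta scaler_sumr -sumrB; apply: eq_bigr => m _.
under eq_bigr => l _ do rewrite scalerA -rmorphM.
rewrite -scaler_suml -scalerBl -rmorph_sum diag_ord.
congr (_ *: _); rewrite -(rmorph_nat (real_complex R)) -fmorphV -rmorphB; congr (_%:C)%C.
have := sum_helmert x (ltn_ord m); rewrite sum_diag div1r => <-.
rewrite -sum_ord_gt0; apply: eq_bigr => l _.
set y := _ - _ * _; set c := _ - _.
have -> : helmert_scale (sval l) / 2 * y * (helmert_scale (sval l) * c) =
    c * (helmert_scale (sval l) ^+ 2 / 2 * y) by ring.
by rewrite helmert_scale_sq; congr (_ * _); rewrite mulrC [2 / _]mulrC mulfK ?pnatr_eq0.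
Qed.

(** Parseval: 2 is the squared norm of a Gell-Mann matrix, 1/d that of the part of [X] along the
    identity. *)
Lemma sum_bloch_coord_sq : 2 * \sum_g bloch_coord g ^+ 2 =
  \sum_i \sum_j (complex.Re (X i j) ^+ 2 + complex.Im (X i j) ^+ 2) - (d%:R)^-1.
Proof.
rewrite sum_GMidx sum_pairs_lt mulrDr -addrA; congr (_ + _).
  rewrite -(sum_sig _ (fun p : 'I_d * 'I_d =>
     complex.Re (X p.1 p.2) ^+ 2 + complex.Im (X p.1 p.2) ^+ 2 +
     (complex.Re (X p.2 p.1) ^+ 2 + complex.Im (X p.2 p.1) ^+ 2))) mulr_sumr.
  apply: eq_bigr => p _; rewrite /bloch_coord (hermitian_entry (sval p).1 (sval p).2).
  by case: (X _ _) => a b /=; ring.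
have -> : \sum_i (complex.Re (X i i) ^+ 2 + complex.Im (X i i) ^+ 2) =
    \sum_(0 <= i < d) x i ^+ 2.
  by rewrite big_mkord; apply: eq_bigr => i _; rewrite diag_ord /= expr0n addr0.
have := sum_helmert_sq x (ltnW d2); rewrite sum_diag expr1n div1r => <-.
rewrite -sum_ord_gt0 mulr_sumr; apply: eq_bigr => l _ /=.
rewrite exprMn expr_div_n helmert_scale_sq.
set y := _ - _; move: ((_ * (_ + 1))^-1) => b; by field.
Qed.

End GellMann.

(** * Positive semidefinite matrices: 2x2 minors and trace inequalities *)

Lemma mx_form_pair (K : comNzRingType) n (A : 'M[K]_n) (i j : 'I_n) (a b c d : K) :
  ((a *: delta_mx 0 i + b *: delta_mx 0 j) *m A *m
     (c *: delta_mx i 0 + d *: delta_mx j 0) : 'M[K]_1) 0 0 =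
  a * c * A i i + a * d * A i j + b * c * A j i + b * d * A j j.
Proof.
have F k l : ((delta_mx 0 k : 'rV[K]_n) *m A *m (delta_mx l 0 : 'cV[K]_n)) 0 0 = A k l.
  by rewrite -rowE -colE !mxE.
rewrite !mulmxDl !mulmxDr -!scalemxAl -!scalemxAr.
have addE (P Q : 'M[K]_1) : (P + Q) 0 0 = P 0 0 + Q 0 0 by rewrite mxE.
have scaleE e (P : 'M[K]_1) : (e *: P) 0 0 = e * P 0 0 by rewrite mxE.
by rewrite !addE !scaleE !F; ring.
Qed.

Section Psd.
Variable R : realType.
Local Notation C := R[i].

Lemma conjCE (z : C) : Num.conj z = conjc z. Proof. by []. Qed.

Lemma adjmxK m n (A : 'M[C]_(m, n)) : adjmx (adjmx A) = A.
Proof. by apply/matrixP => i j; rewrite !mxE conjCK. Qed.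

Lemma psd_form_pair n (A : 'M[C]_n) (i j : 'I_n) (a b : C) : psd A ->
  0 <= a^* * a * A i i + a^* * b * A i j + b^* * a * A j i + b^* * b * A j j.
Proof.
move=> /(_ (a *: delta_mx i 0 + b *: delta_mx j 0)).
have E k c : adjmx (c *: delta_mx k 0 : 'cV[C]_n) = c^* *: delta_mx 0 k.
  apply/matrixP => x y; rewrite !mxE /= rmorphM /=.
  by rewrite andbC; case: (_ && _); rewrite ?rmorph1 ?rmorph0.
have -> : adjmx (a *: delta_mx i 0 + b *: delta_mx j 0 : 'cV[C]_n) =
  a^* *: delta_mx 0 i + b^* *: delta_mx 0 j.
  by rewrite -!E; apply/matrixP => x y; rewrite !mxE rmorphD.
by rewrite mx_form_pair.
Qed.

Lemma psd_diag_ge0 n (A : 'M[C]_n) i : psd A -> 0 <= A i i.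
Proof.
move=> /(@psd_form_pair _ _ i i 1 0).
by rewrite rmorph1 rmorph0 !mul0r !mulr0 !mul0r !mul1r !addr0.
Qed.

(** Nonnegative complex numbers are real: the form at e_i + e_j settles the imaginary parts of the
    entries, at e_i + i e_j the real parts. *)
Lemma psd_herm n (A : 'M[C]_n) : psd A -> is_hermitian A.
Proof.
move=> Ap; apply/matrixP => i j; rewrite !mxE.
have := psd_diag_ge0 i Ap; have := psd_diag_ge0 j Ap.
have := psd_form_pair i j 1 1 Ap; have := psd_form_pair i j 1 (iC R) Ap.
rewrite !conjCE !lecE; case: (A i i) (A i j) (A j i) (A j j) => [a b] [c d] [e f] [g h] /=.
simpc.
move=> /andP[/eqP h1 _] /andP[/eqP h2 _] /andP[/eqP h3 _] /andP[/eqP h4 _].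
by apply/eqP; rewrite eq_complex /=; apply/andP; split; apply/eqP; lra.
Qed.

Lemma psd_normsq_le n (A : 'M[C]_n) i j : psd A -> `|A i j| ^+ 2 <= A i i * A j j.
Proof.
move=> Ap; have Ah : A j i = (A i j)^* by rewrite -{1}(psd_herm Ap) !mxE.
have ai := psd_diag_ge0 i Ap; have aj := psd_diag_ge0 j Ap.
(* The test vector is t e_i - s conj(A_ij) e_j with t, s real, so that A_ij enters only through its
   modulus. *)
have key t s : t^* = t -> s^* = s ->
    0 <= t ^+ 2 * A i i - 2 * t * s * `|A i j| ^+ 2 + s ^+ 2 * `|A i j| ^+ 2 * A j j.
  move=> ht hs; have := psd_form_pair i j t (- s * (A i j)^*) Ap.
  rewrite Ah rmorphM rmorphN /= conjCK ht hs normCK => H; apply: (le_trans H).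
  by rewrite le_eqVlt; apply/orP; left; apply/eqP; ring.
case: (eqVneq (A j j) 0) => [z|nz].
  rewrite z mulr0; case: (eqVneq (A i j) 0) => [->|nzij]; first by rewrite normr0 expr0n.
  have N0 : 0 < `|A i j| ^+ 2 by rewrite exprn_gt0 // normr_gt0.
  (* When A_jj = 0 and A_ij is nonzero, this [s] gives the form the negative value -(A_ii + 2). *)
  have := key 1 ((A i i + 1) / `|A i j| ^+ 2) (rmorph1 _).
  rewrite z mulr0 addr0 expr1n mul1r mulr1 -mulrA divfK ?gt_eqF //.
  have -> : A i i - 2 * (A i i + 1) = - (A i i + 2) by ring.
  rewrite oppr_ge0 => H; suff: A i i + 2 <= 0 by rewrite lt_geF // ltr_wpDl.
  by apply/H/geC0_conj; rewrite divr_ge0 ?addr_ge0 ?exprn_ge0.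
(* These values give A_jj times the 2x2 minor. *)
have := key (A j j) 1 (geC0_conj aj) (rmorph1 _).
have -> : A j j ^+ 2 * A i i - 2 * A j j * 1 * `|A i j| ^+ 2 + 1 ^+ 2 * `|A i j| ^+ 2 * A j j
   = A j j * (A i i * A j j - `|A i j| ^+ 2) by ring.
by rewrite pmulr_rge0 ?subr_ge0 // lt_def nz aj.
Qed.

(** The left side is tr (A^2), as A is Hermitian; the bounds A_ii A_jj of the minors add up to (tr
    A)^2. *)
Lemma psd_sum_normsq_le n (A : 'M[C]_n) : psd A ->
  \sum_i \sum_j `|A i j| ^+ 2 <= (\tr A) ^+ 2.
Proof.
move=> Ap; rewrite expr2 /mxtrace mulr_suml; apply: ler_sum => i _.
by rewrite mulr_sumr; apply: ler_sum => j _; apply: psd_normsq_le.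
Qed.

(** Diagonalizing A by a unitary U turns the trace into a sum of eigenvalues of A times diagonal
    entries of U B U*. *)
Lemma psd_trmul_ge0 n (A B : 'M[C]_n) : psd A -> psd B -> 0 <= \tr (A *m B).
Proof.
move=> Ap Bp.
have An : A \is spectral.normalmx.
  by apply/spectral.normalmxP; rewrite -map_trmx -/(adjmx A) psd_herm.
set U := spectral.spectralmx A.
have Uu : U \is spectral.unitarymx := spectral.spectral_unitarymx A.
have iU : invmx U = adjmx U by rewrite spectral.invmx_unitary // -map_trmx.
(* Such an entry is the quadratic form of X at the adjoint of row i of U; X = A gives the sign of
   the eigenvalues. *)
have conj_psd (X : 'M[C]_n) i : psd X -> 0 <= (U *m X *m adjmx U) i i.
  move=> /(_ (adjmx (row i U))); rewrite adjmxK -row_mul => H.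
  by rewrite (le_trans H) // le_eqVlt mxE [in X in _ || X]mxE; apply/orP; left; apply/eqP;
    rewrite !mxE; apply: eq_bigr => k _; rewrite !mxE.
have UU : adjmx U *m U = 1%:M by rewrite -iU mulVmx // spectral.spectral_unit.
have UU' : U *m adjmx U = 1%:M by rewrite -iU mulmxV // spectral.spectral_unit.
have := spectral.orthomx_spectralP An; rewrite -/U iU.
set D := diag_mx _ => E.
have DE : D = U *m A *m adjmx U.
  by rewrite E !mulmxA UU' mul1mx -mulmxA UU' mulmx1.
have -> : \tr (A *m B) = \tr (D *m (U *m B *m adjmx U)).
  have -> : A *m B = adjmx U *m (D *m (U *m B)) by rewrite !mulmxA -E.
  by rewrite mxtrace_mulC -!mulmxA.
rewrite mul_diag_mx /mxtrace; apply: sumr_ge0 => i _; rewrite mxE mulr_ge0 ?conj_psd //.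
by have := conj_psd A i Ap; rewrite -DE mxE eqxx.
Qed.
End Psd.

(** * The linear map from Alice's effects to Bob's operators *)

Section Reduction.
Variable R : realType.
Local Notation C := R[i].
Variables dA dB : nat.

(** The assemblage element: Bob's unnormalized conditional operator for Alice's effect [E]. *)
Definition steer (X : 'M[C]_(dA * dB)) (E : 'M[C]_dA) : 'M[C]_dB :=
  ptrA ((E *t (1%:M : 'M[C]_dB)) *m X).

Lemma ptrA_is_linear : linear (@ptrA R dA dB).
Proof.
move=> c X Y; apply/matrixP => i j; rewrite !mxE mulr_sumr -big_split /=.
by apply: eq_bigr => a _; rewrite !mxE.
Qed.

HB.instance Definition _ := GRing.isLinear.Build C _ _ _ (@ptrA R dA dB) ptrA_is_linear.

Lemma tensmx_is_linear (B : 'M[C]_dB) : linear (fun A : 'M[C]_dA => A *t B).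
Proof. by move=> c X Y; apply/matrixP => i j; rewrite !mxE mulrDl mulrA. Qed.

Lemma steer_is_linear X : linear (steer X).
Proof.
move=> c E F; rewrite /steer (tensmx_is_linear 1%:M) mulmxDl -scalemxAl.
by rewrite linearP.
Qed.

HB.instance Definition _ X := GRing.isLinear.Build C _ _ _ (steer X) (steer_is_linear X).

Lemma steerD X E F : steer X (E + F) = steer X E + steer X F.
Proof. exact: raddfD. Qed.

Lemma steerZ X c E : steer X (c *: E) = c *: steer X E.
Proof. exact: linearZ. Qed.

Lemma steer_sum X (I : Type) (s : seq I) (E : I -> 'M[C]_dA) :
  steer X (\sum_(i <- s) E i) = \sum_(i <- s) steer X (E i).
Proof. exact: raddf_sum. Qed.

Lemma steerDl E X Y : steer (X + Y) E = steer X E + steer Y E.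
Proof. by rewrite /steer mulmxDr raddfD. Qed.

Lemma steerZl E c X : steer (c *: X) E = c *: steer X E.
Proof. by rewrite /steer -scalemxAr linearZ. Qed.

Lemma tens11mx : (1%:M : 'M[C]_dA) *t (1%:M : 'M[C]_dB) = 1%:M.
Proof.
apply/matrixP => i j; case: (mxtens_indexP i) => i1 i2; case: (mxtens_indexP j) => j1 j2.
rewrite tensmxE !mxE (can_eq (@mxtens_indexK _ _)) xpair_eqE.
by rewrite -natrM mulnb.
Qed.

Lemma steer1 X : steer X 1%:M = ptrA X.
Proof. by rewrite /steer tens11mx mul1mx. Qed.

Lemma steer_tens (A : 'M[C]_dA) (B : 'M[C]_dB) E : steer (A *t B) E = \tr (E *m A) *: B.
Proof.
rewrite /steer tensmx_mul mul1mx; apply/matrixP => i j; rewrite !mxE mulr_suml.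
by apply: eq_bigr => a _; rewrite tensmxE.
Qed.

End Reduction.

(** * Integrals of hidden states weighted by real functions *)

Section WeightedIntegral.
Variables (R : realType) (dsp : measure_display) (T : measurableType dsp).
Variables (mu : probability T R) (n : nat) (sig : T -> 'M[R[i]]_n).

(* The vector-valued integral of [f l *: sig l] exists and equals [Z]. *)
Definition wint (f : T -> R) (Z : 'M[R[i]]_n) : Prop :=
  forall i j,
    mu.-integrable setT (fun l => (f l * complex.Re (sig l i j))%:E) /\
    mu.-integrable setT (fun l => (f l * complex.Im (sig l i j))%:E) /\
    (\int[mu]_l (f l * complex.Re (sig l i j))%:E = (complex.Re (Z i j))%:E)%E /\
    (\int[mu]_l (f l * complex.Im (sig l i j))%:E = (complex.Im (Z i j))%:E)%E.

(** Integrability and value are carried together, so that one statement serves real and imaginary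
    parts alike. *)
Lemma integral_eqD (f g h : T -> R) (a b : R) : (forall l, h l = f l + g l) ->
  mu.-integrable setT (EFin \o f) /\ (\int[mu]_l (f l)%:E = a%:E)%E ->
  mu.-integrable setT (EFin \o g) /\ (\int[mu]_l (g l)%:E = b%:E)%E ->
  mu.-integrable setT (EFin \o h) /\ (\int[mu]_l (h l)%:E = (a + b)%:E)%E.
Proof.
move=> /funext -> [fi fe] [gi ge].
split; first exact: (@integrableD _ _ _ mu setT measurableT _ _ fi gi).
by rewrite (@integralD_EFin _ _ _ mu setT measurableT _ _ fi gi) /= fe ge.
Qed.

Lemma integral_eqZ (k : R) (f h : T -> R) (a : R) : (forall l, h l = k * f l) ->
  mu.-integrable setT (EFin \o f) /\ (\int[mu]_l (f l)%:E = a%:E)%E ->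
  mu.-integrable setT (EFin \o h) /\ (\int[mu]_l (h l)%:E = (k * a)%:E)%E.
Proof.
move=> /funext -> [fi fe].
split; first exact: (@integrableZl _ _ _ mu setT measurableT k _ fi).
by under eq_integral do rewrite EFinM; rewrite (@integralZl _ _ _ mu setT measurableT _ fi) fe.
Qed.

Lemma wintD f g Z W : wint f Z -> wint g W -> wint (fun l => f l + g l) (Z + W).
Proof.
move=> Hf Hg i j; have [f1 [f2 [f3 f4]]] := Hf i j; have [g1 [g2 [g3 g4]]] := Hg i j.
have E k : (f k + g k) * complex.Re (sig k i j) =
    f k * complex.Re (sig k i j) + g k * complex.Re (sig k i j) by rewrite mulrDl.
have E' k : (f k + g k) * complex.Im (sig k i j) =
    f k * complex.Im (sig k i j) + g k * complex.Im (sig k i j) by rewrite mulrDl.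
have [h1 h3] := integral_eqD E (conj f1 f3) (conj g1 g3).
have [h2 h4] := integral_eqD E' (conj f2 f4) (conj g2 g4).
rewrite mxE; do ![split => //].
  by rewrite h3; case: (Z i j) (W i j) => ? ? [].
by rewrite h4; case: (Z i j) (W i j) => ? ? [].
Qed.

Lemma wintZ k f Z : wint f Z -> wint (fun l => k * f l) (k%:C%C *: Z).
Proof.
move=> Hf i j; have [f1 [f2 [f3 f4]]] := Hf i j.
have E l : (k * f l) * complex.Re (sig l i j) = k * (f l * complex.Re (sig l i j))
    by rewrite mulrA.
have E' l : (k * f l) * complex.Im (sig l i j) = k * (f l * complex.Im (sig l i j))
    by rewrite mulrA.
have [h1 h3] := integral_eqZ E (conj f1 f3).
have [h2 h4] := integral_eqZ E' (conj f2 f4).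
rewrite mxE; do ![split => //].
  by rewrite h3; case: (Z i j) => ? ? /=; rewrite mul0r subr0.
by rewrite h4; case: (Z i j) => ? ? /=; rewrite mul0r addr0.
Qed.

Lemma wint_sum (I : Type) (s : seq I) (f : I -> T -> R) (Z : I -> 'M[R[i]]_n) :
  (forall i, wint (f i) (Z i)) -> wint (fun l => \sum_(i <- s) f i l) (\sum_(i <- s) Z i).
Proof.
move=> H; elim: s => [|i s IH].
  have I0 (g : T -> R) : mu.-integrable setT (fun l => ((\sum_(i <- [::]) f i l) * g l)%:E) /\
      (\int[mu]_l ((\sum_(i <- [::]) f i l) * g l)%:E = 0)%E.
    have -> : (fun l => ((\sum_(i <- [::]) f i l) * g l)%:E) = cst 0%E.
      by apply/funext => l; rewrite big_nil mul0r.
    by split; [exact: integrable0 | exact: integral0].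
  move=> i j; rewrite big_nil mxE.
  have [? ?] := I0 (fun l => complex.Re (sig l i j)).
  by have [] := I0 (fun l => complex.Im (sig l i j)).
rewrite big_cons.
rewrite (_ : (fun l => \sum_(i0 <- i :: s) f i0 l) = fun l => f i l + \sum_(i0 <- s) f i0 l).
  exact: wintD.
by apply/funext => l; rewrite big_cons.
Qed.
End WeightedIntegral.

(** * Bloch vectors of effects and the conic hull of the measured projectors *)

Lemma scale_affineK (K : fieldType) (V : lmodType K) (c : K) (e x : V) : c != 0 ->
  x = c^-1 *: (e + c *: (x - c^-1 *: e)).
Proof.
by move=> c0; rewrite scalerBr scalerA divff // scale1r addrC subrK scalerA mulVf // scale1r.
Qed.

(** With [c] the dimension, [t] the trace of [x] and [e] the identity: shrinking the Bloch vector of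
    x / t by [r] mixes [x] with white noise. *)
Lemma scale_affine_mix (K : fieldType) (V : lmodType K) (c t r : K) (e x : V) :
  c != 0 -> t != 0 ->
  t *: (c^-1 *: (e + r *: (c / t *: x - e))) = r *: x + ((1 - r) * (t / c)) *: e.
Proof.
move=> c0 t0; rewrite !(scalerBr, scalerDr, scalerA) addrCA -scalerBl.
by congr (_ *: _ + _ *: _); field; rewrite ?c0 ?t0.
Qed.

(** The last comparison for an effect E: [t] is tr E, [g] is tr (E gamma), and [x], [e] are Bob's
    operators under O for E and for the identity. *)
Lemma scale_mixture (K : fieldType) (V : lmodType K) (c r t g : K) (x e : V) : c != 0 ->
  c^-1 *: (r *: x + ((1 - r) * (t / c)) *: e) + g *: (e + - c^-1 *: e) =
  c^-1 *: (r *: x + (1 - r) *: ((c^-1 * t) *: e)) + ((c - 1) / c) *: (g *: e).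
Proof.
move=> c0; rewrite !(scalerDr, scalerA) -!addrA -!scalerDl.
by congr (_ + _ *: _); field.
Qed.

Section Hull.
Variable R : realType.
Local Notation C := R[i].

Lemma psd_tr_eq0 d (E : 'M[C]_d) : psd E -> \tr E = 0 -> E = 0.
Proof.
move=> Ep E0; have := psd_sum_normsq_le Ep; rewrite E0 expr0n /= => H.
have row_ge0 i : 0 <= \sum_j `|E i j| ^+ 2 by apply: sumr_ge0 => j _; rewrite exprn_ge0.
have /eqP : \sum_i \sum_j `|E i j| ^+ 2 = 0 by apply/le_anti; rewrite H sumr_ge0.
rewrite psumr_eq0 // => /allP Hi; apply/matrixP => i j; rewrite mxE; apply/eqP.
have := Hi i (mem_index_enum _); rewrite psumr_eq0 => [/allP/(_ j (mem_index_enum _))|k _].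
  by rewrite /= sqrf_eq0 normr_eq0.
by rewrite exprn_ge0.
Qed.

(** As [kappa] squared is d (d - 1) / 2, the squared norm equals (d tr (Y^2) - 1) / (d - 1), and tr
    (Y^2) <= 1. *)
Lemma density_bloch d (Y : 'M[C]_d) : (2 <= d)%N -> density Y ->
  exists u : GMidx d -> R, bloch Y u /\ \sum_g u g ^+ 2 <= 1.
Proof.
move=> d2 [Yp Ytr]; have Yh := psd_herm Yp.
have d0 : d%:R != 0 :> R by rewrite pnatr_eq0 -lt0n ltnW.
have d1 : 0 < d%:R - 1 :> R by rewrite subr_gt0 ltr1n.
have dp : 0 < d%:R :> R by rewrite ltr0n ltnW.
have k2 : kappa R d ^+ 2 = d%:R * (d%:R - 1) / 2.
  by rewrite sqr_sqrtr // divr_ge0 // mulr_ge0 // ltW.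
have k0 : kappa R d != 0.
  by rewrite -sqrf_eq0 k2 mulf_neq0 ?invr_neq0 // mulf_neq0 // gt_eqF.
exists (fun g => d%:R * bloch_coord Y g / kappa R d); split.
  rewrite /bloch; under eq_bigr => g _ do rewrite mulfVK // rmorphM -scalerA.
  rewrite -scaler_sumr sum_bloch_coord // (rmorph_nat (real_complex R)).
  by apply: scale_affineK; rewrite pnatr_eq0 -lt0n ltnW.
have N1 : \sum_i \sum_j (complex.Re (Y i j) ^+ 2 + complex.Im (Y i j) ^+ 2) <= 1.
  have := psd_sum_normsq_le Yp; rewrite Ytr expr1n -lecR rmorph1; apply: le_trans.
  rewrite rmorph_sum ler_sum // => i _; rewrite rmorph_sum ler_sum // => j _.
  by rewrite -add_Re2_Im2 lexx.
have := sum_bloch_coord_sq d2 Yh Ytr; set s := \sum_(g : GMidx d) _ => sE.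
have -> : \sum_g (d%:R * bloch_coord Y g / kappa R d) ^+ 2 = d%:R ^+ 2 / kappa R d ^+ 2 * s.
  by rewrite mulr_sumr; apply: eq_bigr => g _; rewrite !exprMn exprVn mulrAC.
have -> : d%:R ^+ 2 / kappa R d ^+ 2 * s = d%:R / (d%:R - 1) * (2 * s).
  by rewrite k2; field; rewrite d0 gt_eqF.
rewrite sE mulrAC ler_pdivrMr // mul1r mulrBr divff // lerD2r.
by rewrite ler_piMr // ltW.
Qed.

Lemma psd_conic_hull d (X : finType) (nout : X -> nat)
    (M : forall x : X, 'I_(nout x) -> 'M[C]_d) (r : R) (E : 'M[C]_d) :
  (2 <= d)%N -> 0 <= r -> ball_in (polytope M) r -> psd E ->
  exists W : {x : X & 'I_(nout x)} -> R,
    [/\ forall s, 0 <= W s, (\sum_s W s)%:C%C = \tr E &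
      \sum_s (W s)%:C%C *: M (tag s) (tagged s) =
      r%:C%C *: E + ((1 - r)%:C%C * (\tr E / d%:R)) *: 1%:M].
Proof.
move=> d2 r0 rb Ep.
have dC : d%:R != 0 :> C by rewrite pnatr_eq0 -lt0n ltnW.
(* An effect of trace 0 cannot be normalized, but it vanishes and zero weights serve. *)
have [tr0|tr0] := eqVneq (\tr E) 0.
  exists (fun=> 0); split => //; first by rewrite big1 // rmorph0.
  rewrite tr0 mul0r mulr0 scale0r (psd_tr_eq0 Ep tr0) scaler0 addr0 big1 // => s _.
  by rewrite rmorph0 scale0r.
have trp : 0 < \tr E by rewrite lt_def tr0 sumr_ge0 // => i _; apply: psd_diag_ge0.
have Yd : density ((\tr E)^-1 *: E).
  split; last by rewrite mxtraceZ mulVf.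
  move=> v; rewrite -scalemxAr -scalemxAl mxE mulr_ge0 // invr_ge0.
  exact: ltW.
have [u [uE u1]] := density_bloch d2 Yd.
have /rb : Num.sqrt (\sum_g (r * u g) ^+ 2) <= r.
  rewrite -[leRHS]ger0_norm // -sqrtr_sqr ler_sqrt ?sqr_ge0 //.
  under eq_bigr => g _ do rewrite exprMn.
  by rewrite -mulr_sumr ler_piMr // sqr_ge0.
move=> [n [w [p [Sp [w0 [w1 pE]]]]]].
have /choice[q qE] : forall i, exists s : {x : X & 'I_(nout x)},
    bloch (M (tag s) (tagged s)) (p i).
  by move=> i; have [x [a H]] := Sp i; exists (Tagged (fun x => 'I_(nout x)) a).
have [t tE] : exists t : R, \tr E = t%:C%C.
  by have /complex_realP[t ->] : \tr E \is Num.real by [rewrite gtr0_real|]; exists t.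
have t0 : 0 <= t by move: trp; rewrite tE ltcR => /ltW.
(* Several points of the convex combination may come from the same effect; their weights, scaled by
   t = tr E, are added up. *)
have SM (V : lmodType C) (F : {x : X & 'I_(nout x)} -> V) :
    \sum_s (\sum_(i | q i == s) t * w i)%:C%C *: F s = \sum_i (t * w i)%:C%C *: F (q i).
  rewrite [RHS](partition_big q predT) //=; apply: eq_bigr => s _.
  by rewrite rmorph_sum scaler_suml; apply: eq_bigr => i /eqP ->.
exists (fun s => \sum_(i | q i == s) t * w i); split.
- by move=> s; apply: sumr_ge0 => i _; rewrite mulr_ge0.
- rewrite tE; congr (_%:C)%C; rewrite -[RHS]mulr1 -w1 mulr_sumr.
  by rewrite [RHS](partition_big q predT).
rewrite (SM _ (fun s => M (tag s) (tagged s))).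
(* [G] is linear, hence carries the convex combination and the factor [r] from Bloch vectors to
   matrices. *)
set G := fun v : GMidx d -> R => \sum_g (v g * kappa R d)%:C%C *: gellmann R g.
have GE : G (fun g => r * u g) = \sum_i (w i)%:C%C *: G (p i).
  rewrite /G; under [RHS]eq_bigr => i _ do rewrite scaler_sumr.
  rewrite exchange_big; apply: eq_bigr => g _.
  rewrite pE mulr_suml rmorph_sum scaler_suml; apply: eq_bigr => i _.
  by rewrite scalerA -rmorphM mulrA.
have GE' : G (fun g => r * u g) = r%:C%C *: G u.
  rewrite /G scaler_sumr; apply: eq_bigr => g _.
  by rewrite scalerA -rmorphM mulrA.
have GuE : G u = d%:R / \tr E *: E - 1%:M.
  have -> : d%:R / \tr E *: E = d%:R *: ((\tr E)^-1 *: E) by rewrite scalerA.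
  rewrite uE scalerA divff // scale1r.
  by rewrite [X in _ = X - _]addrC addrK.
transitivity (t%:C%C *: \sum_i (w i)%:C%C *: (d%:R^-1 *: (1%:M + G (p i)))).
  rewrite scaler_sumr; apply: eq_bigr => i _.
  by rewrite scalerA -rmorphM (qE i).
under eq_bigr => i _ do rewrite scalerA mulrC -scalerA scalerDr.
rewrite -scaler_sumr big_split /= -GE GE' -scaler_suml -rmorph_sum w1 rmorph1 scale1r GuE.
rewrite -tE rmorphB rmorph1; exact: scale_affine_mix.
Qed.

End Hull.

(** * The LHS model of [rho] for all POVMs *)

Theorem theorem2 (R : realType) (dA dB : nat)
  (hdA : (2 <= dA)%N) (hdB : (2 <= dB)%N)
  (X : finType) (nout : X -> nat) (M : forall x : X, 'I_(nout x) -> 'M[R[i]]_dA)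
  (hM : forall x, rank1PVM (M x))
  (r : R) (hr : is_insphere_radius (polytope M) r)
  (rho : 'M[R[i]]_(dA * dB)) (hrho : density rho)
  (O : 'M[R[i]]_(dA * dB)) (hOh : is_hermitian O) (hOtr : \tr O = 1)
  (hOLHS : LHS_model M O)
  (gam : 'M[R[i]]_dA) (hgam : density gam)
  (heq : rho = (dA%:R)^-1 *: (r%:C%C *: O
                 + (1 - r)%:C%C *: (((dA%:R)^-1 *: (1%:M : 'M[R[i]]_dA)) *t ptrA O))
               + ((dA%:R - 1) / dA%:R) *: (gam *t ptrA O)) :
  LHS_model (@POVM_eff R dA) rho.
Proof.
have [r0 [rb _]] := hr.
have dC : dA%:R != 0 :> R[i] by rewrite pnatr_eq0 -lt0n ltnW.
have dR : 0 < dA%:R :> R by rewrite ltr0n ltnW.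
(* The weights depend on the operator alone, not on the POVM containing it; when it is not positive
   the condition is void and 0 is a witness. *)
have /choice[W WP] : forall E : 'M[R[i]]_dA, exists W : {x : X & 'I_(nout x)} -> R,
    psd E -> [/\ forall s, 0 <= W s, (\sum_s W s)%:C%C = \tr E &
      \sum_s (W s)%:C%C *: M (tag s) (tagged s) =
      r%:C%C *: E + ((1 - r)%:C%C * (\tr E / dA%:R)) *: 1%:M].
  move=> E; have [Ep|nE] := pselect (psd E); last by exists (fun=> 0).
  by have [W WP] := psd_conic_hull hdA r0 rb Ep; exists W.
(* The zero vector lies in the polytope, and a convex combination has at least one term because its
   weights add up to 1. *)
have [x0] : inhabited X.
  have [|n [w [p [Sp [_ [w1 _]]]]]] := rb (fun=> 0).
    by rewrite big1 ?sqrtr0 // => g _; rewrite expr0n.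
  case: n w p Sp w1 => [|n] w p Sp w1; last by have [x _] := Sp ord0.
  by move: w1; rewrite big_ord0 => /eqP; rewrite eq_sym oner_eq0.
have [dsp [T [mu [P [sig [sigd [PP PI]]]]]]] := hOLHS.
have PI' x a : wint mu sig (P x a) (steer O (M x a)) by move=> i j; apply: PI.
(* Summing over the outcomes of one measurement: responses add up to 1 and effects to the identity,
   so the hidden states average to O_B. *)
have I1 : wint mu sig (fun=> 1) (ptrA O).
  have := wint_sum (index_enum _) (PI' x0).
  rewrite -steer_sum (proj2 (proj1 (hM x0))) steer1.
  congr (wint _ _ _ _); apply/funext => l.
  exact: (PP x0 l).2.
pose S E l := \sum_s W E s * P (tag s) (tagged s) l.
pose Z (E : 'M[R[i]]_dA) : 'M[R[i]]_dA :=
  r%:C%C *: E + ((1 - r)%:C%C * (\tr E / dA%:R)) *: 1%:M.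
have SI E : psd E -> wint mu sig (S E) (steer O (Z E)).
  move=> Ep; have [_ _ WE] := WP E Ep; rewrite /Z -WE steer_sum.
  apply: wint_sum => s; rewrite steerZ; apply: wintZ; exact: PI'.
pose t E := complex.Re (\tr (E *m gam)).
have gamp := hgam.1.
have tE E : psd E -> (t E)%:C%C = \tr (E *m gam).
  by move=> Ep; rewrite RRe_real // ger0_real // psd_trmul_ge0.
have t0 E : psd E -> 0 <= t E.
  by move=> Ep; rewrite -lecR tE // psd_trmul_ge0.
have S0 E l : psd E -> 0 <= S E l.
  move=> Ep; have [W0 _ _] := WP E Ep; apply: sumr_ge0 => s _.
  by rewrite mulr_ge0 // (PP _ _).1.
have S1 E l : psd E -> (S E l)%:C%C <= \tr E.
  move=> Ep; have [W0 <- _] := WP E Ep; rewrite lecR; apply: ler_sum => s _.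
  (* Each response is at most 1, the others of the same measurement being nonnegative. *)
  rewrite ler_piMr // -(PP (tag s) l).2 (bigD1 (tagged s)) //= lerDl.
  by apply: sumr_ge0 => b _; apply: (PP _ _).1.
(* Hidden variable and states are those of O. The leftover 1 - sum_b S_b / d is shared out by gamma,
   and written in the shape of [wintD] and [wintZ]. *)
exists dsp, T, mu, (fun (x : POVMs R dA) a l =>
  let E := POVM_eff (x:=x) in
  dA%:R^-1 * S (E a) l + t (E a) * (1 + - dA%:R^-1 * \sum_b S (E b) l)), sig.
split => //; split.
  move=> [k [E [Ep E1]]] l; rewrite /POVM_eff /POVM_nout /=.
  (* S_b <= tr E_b, and these traces add up to d; hence the leftover is nonnegative. *)
  have Sd : \sum_b S (E b) l <= dA%:R.
    rewrite -lecR rmorph_sum rmorph_nat -(mxtrace1 R[i]) -E1 raddf_sum.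
    by apply: ler_sum => b _; apply: S1.
  split.
    move=> a; rewrite addr_ge0 ?mulr_ge0 ?invr_ge0 ?S0 ?t0 ?(ltW dR) //.
    by rewrite mulNr subr_ge0 mulrC ler_pdivrMr // mul1r.
  rewrite big_split /= -mulr_sumr -mulr_suml.
  have -> : \sum_(a < k) t (E a) = 1.
    apply: (@complexI R); rewrite rmorph_sum rmorph1 -hgam.2 -[gam in RHS]mul1mx.
    rewrite -E1 mulmx_suml raddf_sum.
    by apply: eq_bigr => a _; apply: tE.
  by rewrite mul1r mulNr addrCA subrr addr0.
move=> [k [E [Ep E1]]] a; rewrite /POVM_eff /POVM_nout /=.
suff: wint mu sig (fun l => dA%:R^-1 * S (E a) l +
    t (E a) * (1 + - dA%:R^-1 * \sum_b S (E b) l))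
   (steer rho (E a)) by [].
have := wintD (wintZ dA%:R^-1 (SI _ (Ep a))) (wintZ (t (E a)) (wintD I1 (wintZ (- dA%:R^-1)
  (wint_sum (index_enum _) (fun b => SI _ (Ep b)))))).
congr (wint _ _ _ _).
rewrite -steer_sum.
(* The noise coefficients add up to 1 - r because the traces add up to d, leaving r + (1 - r) = 1
   times the identity. *)
have -> : \sum_b Z (E b) = 1%:M.
  rewrite /Z big_split /= -scaler_sumr E1 -scaler_suml -mulr_sumr -mulr_suml.
  have -> : \sum_b \tr (E b) = dA%:R by rewrite -mxtrace1 -E1 raddf_sum.
  by rewrite divff // mulr1 -scalerDl -rmorphD addrC subrK rmorph1 scale1r.
rewrite steer1 tE // heq steerDl !steerZl steerDl !steerZl !steer_tens.
rewrite /Z steerD !steerZ steer1 -scalemxAr mulmx1 mxtraceZ.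
rewrite rmorphN !fmorphV !rmorph_nat rmorphB rmorph1.
exact: (scale_mixture _ _ _ _ _ dC).
Qed.
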